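(* For all $\alpha,\beta\in\mathcal{F}_{\sim,\neg}$: $\alpha\vdash_{\mathcal{L}_{DBS}}\beta$ if and only if $\alpha\vDash_{\mathbf{4}}\beta$, i.e. $v(\alpha)\le v(\beta)$ for all valuations $v$ in $\mathbf{4}$.
   Context: Formulas $\mathcal{F}_{\sim,\neg}$: built from propositional variables $p,q,r,\ldots$ and constants $\top,\bot$ with binary connectives $\vee,\wedge$ and unary connectives $\sim,\neg$. $\mathbf{4}$ is the double Stone algebra on the lattice chain $0<u_2<u_1<1$ with $\sim 0=1$, $\sim u_1=\sim u_2=\sim 1=0$, $\neg 1=0$, $\neg 0=\neg u_1=\neg u_2=1$. A valuation in $\mathbf{4}$ is a map $v:\mathcal{F}_{\sim,\neg}\to\mathbf{4}$ preserving $\vee,\wedge,\sim,\neg$ with $v(\bot)=0$, $v(\top)=1$. $\vdash_{\mathcal{L}_{DBS}}$ is the least relation on $\mathcal{F}_{\sim,\neg}$ satisfying the following postulates and rules (premises / conclusion), for all formulas. BDLL: $\alpha\vdash\alpha$; $\alpha\vdash\beta,\ \beta\vdash\gamma\,/\,\alpha\vdash\gamma$; $\alpha\wedge\beta\vdash\alpha$, $\alpha\wedge\beta\vdash\beta$; $\alpha\vdash\beta,\ \alpha\vdash\gamma\,/\,\alpha\vdash\beta\wedge\gamma$; $\alpha\vdash\alpha\vee\beta$, $\beta\vdash\alpha\vee\beta$; $\alpha\vdash\gamma,\ \beta\vdash\gamma\,/\,\alpha\vee\beta\vdash\gamma$; $\alpha\wedge(\beta\vee\gamma)\vdash(\alpha\wedge\beta)\vee(\alpha\wedge\gamma)$;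 $\alpha\vdash\top$; $\bot\vdash\alpha$. Additional: $\sim\alpha\wedge\sim\beta\vdash\sim(\alpha\vee\beta)$, $\neg(\alpha\wedge\beta)\vdash\neg\alpha\vee\neg\beta$; $\top\vdash\sim\bot$, $\neg\top\vdash\bot$; $\alpha\vdash\beta\,/\,\sim\beta\vdash\sim\alpha$, $\alpha\vdash\beta\,/\,\neg\beta\vdash\neg\alpha$; $\sim\alpha\wedge\neg\beta\vdash\neg(\alpha\vee\beta)$, $\sim(\alpha\wedge\beta)\vdash\sim\alpha\vee\neg\beta$; $\alpha\wedge\sim\alpha\vdash\bot$, $\top\vdash\alpha\vee\neg\alpha$; $\alpha\wedge\beta\vdash\gamma\,/\,\alpha\wedge\sim\gamma\vdash\sim\beta$, $\gamma\vdash\alpha\vee\beta\,/\,\neg\beta\vdash\alpha\vee\neg\gamma$; $\top\vdash\sim\alpha\vee\sim\sim\alpha$, $\neg\alpha\wedge\neg\neg\alpha\vdash\bot$. *)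

(* Defs.v *)
From mathcomp Require Import all_boot all_order.

Set Implicit Arguments.
Unset Strict Implicit.
Unset Printing Implicit Defensive.

Import Order.TTheory.
Local Open Scope order_scope.

Inductive formula : Type :=
  | Var of nat
  | Top
  | Bot
  | Or of formula & formula
  | And of formula & formula
  | Sim of formula
  | Neg of formula.

Declare Scope fml_scope.
Delimit Scope fml_scope with F.
Bind Scope fml_scope with formula.

Notation "⊤" := Top (at level 0) : fml_scope.
Notation "⊥" := Bot (at level 0) : fml_scope.
Notation "a ∨ b" := (Or a b) (at level 50, left associativity) : fml_scope.
Notation "a ∧ b" := (And a b) (at level 40, left associativity) : fml_scope.
Notation "∼ a" := (Sim a) (at level 35, right associativity) : fml_scope.
Notation "¬ a" := (Neg a) (at level 35, right associativity) : fml_scope.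

Reserved Notation "a ⊢ b" (at level 70, no associativity).

Inductive entails : formula -> formula -> Prop :=
  | ent_refl a : a ⊢ a
  | ent_trans a b c : a ⊢ b -> b ⊢ c -> a ⊢ c
  | ent_andl a b : a ∧ b ⊢ a
  | ent_andr a b : a ∧ b ⊢ b
  | ent_and a b c : a ⊢ b -> a ⊢ c -> a ⊢ b ∧ c
  | ent_orl a b : a ⊢ a ∨ b
  | ent_orr a b : b ⊢ a ∨ b
  | ent_or a b c : a ⊢ c -> b ⊢ c -> a ∨ b ⊢ c
  | ent_distr a b c : a ∧ (b ∨ c) ⊢ (a ∧ b) ∨ (a ∧ c)
  | ent_top a : a ⊢ ⊤
  | ent_bot a : ⊥ ⊢ a
  | ent_sim_or a b : ∼ a ∧ ∼ b ⊢ ∼ (a ∨ b)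
  | ent_neg_and a b : ¬ (a ∧ b) ⊢ ¬ a ∨ ¬ b
  | ent_sim_bot : ⊤ ⊢ ∼ ⊥
  | ent_neg_top : ¬ ⊤ ⊢ ⊥
  | ent_sim_contra a b : a ⊢ b -> ∼ b ⊢ ∼ a
  | ent_neg_contra a b : a ⊢ b -> ¬ b ⊢ ¬ a
  | ent_sim_neg_or a b : ∼ a ∧ ¬ b ⊢ ¬ (a ∨ b)
  | ent_sim_and_neg a b : ∼ (a ∧ b) ⊢ ∼ a ∨ ¬ b
  | ent_sim_contradiction a : a ∧ ∼ a ⊢ ⊥
  | ent_neg_excluded_middle a : ⊤ ⊢ a ∨ ¬ a
  | ent_sim_antilogism a b c : a ∧ b ⊢ c -> a ∧ ∼ c ⊢ ∼ b
  | ent_neg_antilogism a b c : c ⊢ a ∨ b -> ¬ b ⊢ a ∨ ¬ c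
  | ent_sim_stone a : ⊤ ⊢ ∼ a ∨ ∼ ∼ a
  | ent_neg_stone a : ¬ a ∧ ¬ ¬ a ⊢ ⊥
where "a ⊢ b" := (entails a%F b%F).

(* The chain 0 < u_2 < u_1 < 1 is the chain of ordinals 0 < 1 < 2 < 3; its
   lattice operations, [\bot] and [\top] are those of the order library. *)
Notation four := 'I_4.

Definition u2 : four := Ordinal (isT : 1 < 4)%N.
Definition u1 : four := Ordinal (isT : 2 < 4)%N.

Definition sim4 (x : four) : four := if x == \bot then \top else \bot.
Definition neg4 (x : four) : four := if x == \top then \bot else \top.

Fact four_chain : (\bot < u2) && (u2 < u1) && (u1 < \top).
Proof. by []. Qed.

Fact four_enum (x : four) : [|| x == \bot, x == u2, x == u1 | x == \top].
Proof. by case: x => [[|[|[|[|]]]]]. Qed.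

Fact sim4_table :
  [/\ sim4 \bot = \top, sim4 u2 = \bot, sim4 u1 = \bot & sim4 \top = \bot].
Proof. by []. Qed.

Fact neg4_table :
  [/\ neg4 \bot = \top, neg4 u2 = \top, neg4 u1 = \top & neg4 \top = \bot].
Proof. by []. Qed.

Record valuation (v : formula -> four) : Prop := Valuation {
  val_or a b : v (a ∨ b)%F = v a `|` v b;
  val_and a b : v (a ∧ b)%F = v a `&` v b;
  val_sim a : v (∼ a)%F = sim4 (v a);
  val_neg a : v (¬ a)%F = neg4 (v a);
  val_bot : v ⊥%F = \bot;
  val_top : v ⊤%F = \top
}.

Definition sem_entails (a b : formula) : Prop :=
  forall v : formula -> four, valuation v -> v a <= v b.

Notation "a ⊨ b" := (sem_entails a%F b%F) (at level 70, no associativity).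

(* Main.v *)
(* Kalmár-style completeness.  A pair of formulas (c, d) is read as a partial
   description of a prime filter containing c and omitting d; a formula f is
   decided in when c ⊢ f ∨ d and decided out when c ∧ f ⊢ d.  A prime filter P of
   a double Stone algebra gives rise to a homomorphism to the four-element chain
   by sending x to \bot when ∼ x ∈ P, to \top when ¬ x ∉ P, and otherwise to u1 or
   u2 according to whether x ∈ P.  Hence once ∼ p, ¬ p and p are decided for all
   variables p of a formula, so are ∼ f, ¬ f and f for its subformulas f,
   consistently with a valuation.  If a ⊨ b, then (a, b) can have no consistent
   extension deciding all variables of a and b, and repeated cuts on ∼ p, ¬ p
   and p yield a ⊢ b. *)
Require Import Defs.
From mathcomp Require Import all_boot all_order.

Set Implicit Arguments.
Unset Strict Implicit.
Unset Printing Implicit Defensive.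

Import Order.TTheory.
Local Open Scope order_scope.

(** * Soundness *)

Lemma entails_sound a b : a ⊢ b -> a ⊨ b.
Proof.
move=> ab v vP; elim: ab => {a b}.
- by [].
- by move=> a b c _ + _; exact: le_trans.
- by move=> a b; rewrite (val_and vP) leIl.
- by move=> a b; rewrite (val_and vP) leIr.
- by move=> a b c _ ab _ ac; rewrite (val_and vP) lexI ab.
- by move=> a b; rewrite (val_or vP) leUl.
- by move=> a b; rewrite (val_or vP) leUr.
- by move=> a b c _ ac _ bc; rewrite (val_or vP) leUx ac.
- by move=> a b c; rewrite !(val_and vP, val_or vP) meetUr.
- by move=> a; rewrite (val_top vP) lex1.
- by move=> a; rewrite (val_bot vP) le0x.
(* The remaining cases concern [∼] and [¬]. The values of formulas are generalized to arbitrary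
   elements of the chain, which leaves a finite check. *)
all: intros; try match goal with
  | ab : entails _ _, vab : is_true _ |- _ => move: vab => {ab} end.
all: rewrite ?(val_and vP, val_or vP, val_sim vP, val_neg vP, val_bot vP,
  val_top vP).
all: repeat match goal with f : formula |- _ => move: (v f) => {f} end.
all: by repeat case=> [[|[|[|[|?]]]] ?].
Qed.

(** * Derived rules: cut, negations, De Morgan laws *)

Lemma ent_and_l a b c : a ⊢ c -> a ∧ b ⊢ c.
Proof. exact/ent_trans/ent_andl. Qed.

Lemma ent_and_r a b c : b ⊢ c -> a ∧ b ⊢ c.
Proof. exact/ent_trans/ent_andr. Qed.

Lemma ent_or_l a b c : a ⊢ b -> a ⊢ b ∨ c.
Proof. by move=> ab; apply: ent_trans ab (ent_orl _ _). Qed.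

Lemma ent_or_r a b c : a ⊢ c -> a ⊢ b ∨ c.
Proof. by move=> ac; apply: ent_trans ac (ent_orr _ _). Qed.

Create HintDb lattice.
#[local] Hint Resolve ent_refl ent_top ent_bot ent_and ent_or ent_and_l
  ent_and_r ent_or_l ent_or_r : lattice.

Lemma ent_and_or a b c d : a ∧ b ⊢ d -> a ∧ c ⊢ d -> a ∧ (b ∨ c) ⊢ d.
Proof. by move=> bd cd; apply: ent_trans (ent_distr _ _ _) (ent_or bd cd). Qed.

(** Distributivity in the form of a cut rule: [c] entails [c ∧ (f ∨ d)], and both disjuncts lead to
    [d]. *)
Lemma ent_cut f c d : c ∧ f ⊢ d -> c ⊢ f ∨ d -> c ⊢ d.
Proof.
move=> cfd cf; apply: (@ent_trans _ (c ∧ (f ∨ d))%F); first by auto with lattice.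
by apply: ent_and_or; auto with lattice.
Qed.

Lemma ent_or_and a b c d : d ⊢ a ∨ b -> d ⊢ a ∨ c -> d ⊢ a ∨ (b ∧ c).
Proof.
move=> ab ac; apply: (@ent_cut b); last by apply: ent_trans ab _; auto with lattice.
apply: (@ent_cut c); first by auto with lattice.
by apply: ent_and_l; apply: ent_trans ac _; auto with lattice.
Qed.

(** Antilogism with [⊥] as its third formula, where [∼ ⊥] is provable: [∼ b] is the pseudocomplement
    of [b]. Dually for [¬] in the next lemma. *)
Lemma ent_sim_intro a b : a ∧ b ⊢ ⊥ -> a ⊢ ∼ b.
Proof.
move/ent_sim_antilogism; apply: ent_trans; apply: ent_and; first exact: ent_refl.
exact: ent_trans (ent_top _) ent_sim_bot.
Qed.

Lemma ent_neg_elim a b : ⊤ ⊢ a ∨ b -> ¬ b ⊢ a.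
Proof.
move/ent_neg_antilogism => /ent_trans; apply; apply: ent_or; first exact: ent_refl.
exact: ent_trans ent_neg_top (ent_bot _).
Qed.

Lemma ent_contradiction a b c : c ⊢ a -> c ⊢ ∼ a -> c ⊢ b.
Proof.
move=> ca cna; apply: ent_trans (ent_bot _).
exact: ent_trans (ent_and ca cna) (ent_sim_contradiction _).
Qed.

Lemma ent_exhaust a b c : a ⊢ c -> ¬ a ⊢ c -> b ⊢ c.
Proof.
move=> ac nac; apply: ent_trans (ent_top _) _.
exact: ent_trans (ent_neg_excluded_middle a) (ent_or ac nac).
Qed.

(** This rests on the Stone law, by splitting on [∼ a ∨ ∼ ∼ a]. In the second case
    [∼ (a ∧ b) ∧ b ⊢ ∼ a] makes [b] contradict [∼ ∼ a], which gives [∼ b]. *)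
Lemma sim_and a b : ∼ (a ∧ b) ⊢ ∼ a ∨ ∼ b.
Proof.
have H : ∼ (a ∧ b) ∧ ∼ ∼ a ⊢ ∼ b.
  apply: ent_sim_intro; apply: (@ent_contradiction (∼ a)); last by auto with lattice.
  apply: (@ent_trans _ (∼ (a ∧ b) ∧ b)%F); first by auto with lattice.
  by apply: ent_sim_intro; apply: (@ent_contradiction (a ∧ b)); auto with lattice.
apply: (@ent_trans _ (∼ (a ∧ b) ∧ (∼ a ∨ ∼ ∼ a))%F).
  by apply: ent_and (ent_refl _) (ent_trans (ent_top _) (ent_sim_stone a)).
by apply: ent_and_or; auto with lattice.
Qed.

(** Dual to [sim_and]: the extra disjunct [¬ ¬ a] in [H] is removed by the Stone law for [¬]. *)
Lemma neg_or a b : ¬ a ∧ ¬ b ⊢ ¬ (a ∨ b).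
Proof.
have H : ¬ b ⊢ ¬ (a ∨ b) ∨ ¬ ¬ a.
  apply: ent_neg_elim.
  apply: (@ent_exhaust (¬ a)); last by auto with lattice.
  apply: (@ent_trans _ (¬ (a ∨ b) ∨ b)%F); last by auto with lattice.
  by apply: ent_neg_elim; apply: (@ent_exhaust (a ∨ b)); auto with lattice.
apply: (@ent_trans _ (¬ a ∧ (¬ (a ∨ b) ∨ ¬ ¬ a))%F); first by auto with lattice.
apply: ent_and_or; first by auto with lattice.
exact: ent_trans (ent_neg_stone a) (ent_bot _).
Qed.

(** * Formulas decided by a pair *)

Definition decides (c d f : formula) (x : bool) : Prop :=
  if x then c ⊢ f ∨ d else c ∧ f ⊢ d.

Lemma decides_mono c d c' d' f x :
  c' ⊢ c -> d ⊢ d' -> decides c d f x -> decides c' d' f x.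
Proof.
rewrite /decides; case: x => cc dd H.
  by apply: ent_trans cc (ent_trans H _); auto with lattice.
by apply: ent_trans (ent_trans H dd); auto with lattice.
Qed.

Lemma decides_equiv c d f g x :
  f ⊢ g -> g ⊢ f -> decides c d f x -> decides c d g x.
Proof.
rewrite /decides; case: x => fg gf H.
  by apply: ent_trans H _; auto with lattice.
by apply: ent_trans H; auto with lattice.
Qed.

Lemma decides_and c d f g x y :
  decides c d f x -> decides c d g y -> decides c d (f ∧ g)%F (x && y).
Proof.
rewrite /decides; case: x y => [] [] /= F G.
- apply: (@ent_trans _ (d ∨ (f ∧ g))%F); last by auto with lattice.
  by apply: ent_or_and; [apply: ent_trans F _|apply: ent_trans G _];
    auto with lattice.
- by apply: ent_trans G; auto with lattice.
- by apply: ent_trans F; auto with lattice.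
- by apply: ent_trans F; auto with lattice.
Qed.

Lemma decides_or c d f g x y :
  decides c d f x -> decides c d g y -> decides c d (f ∨ g)%F (x || y).
Proof.
rewrite /decides; case: x y => [] [] /= F G.
- by apply: ent_trans F _; auto with lattice.
- by apply: ent_trans F _; auto with lattice.
- by apply: ent_trans G _; auto with lattice.
- exact: ent_and_or.
Qed.

Lemma decides_compl c d f g x :
  f ∧ g ⊢ ⊥ -> ⊤ ⊢ f ∨ g -> decides c d f x -> decides c d g (~~ x).
Proof.
rewrite /decides; case: x => /= fg0 fg1 F.
  apply: (@ent_cut f); last by apply: ent_and_l.
  by apply: ent_trans (ent_trans fg0 (ent_bot _)); auto with lattice.
apply: (@ent_cut f); first by auto with lattice.
by apply: ent_trans (ent_top _) (ent_trans fg1 _); auto with lattice.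
Qed.

(** The pair is refined to [(c ∧ f, d)], which decides [f] in, and to [(c, f ∨ d)], which decides it
    out; a cut on [f] joins the two outcomes. *)
Lemma decides_cut c d f :
  (forall x c' d', c' ⊢ c -> d ⊢ d' -> decides c' d' f x -> c' ⊢ d') -> c ⊢ d.
Proof.
rewrite /decides => H; apply: (@ent_cut f).
  by apply: (H true); auto with lattice.
by apply: (H false); auto with lattice.
Qed.

(** The Booleans tell whether [sim4 x], [neg4 x] and [x] lie in the prime filter of elements above
    [u1]; together they determine [x]. *)
Definition decides4 (c d f : formula) (x : four) : Prop :=
  [/\ decides c d (∼ f)%F (x == \bot), decides c d (¬ f)%F (x != \top)
    & decides c d f (u1 <= x)].

Lemma decides4_mono c d c' d' f x :
  c' ⊢ c -> d ⊢ d' -> decides4 c d f x -> decides4 c' d' f x.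
Proof. by move=> cc dd [? ? ?]; split; apply: decides_mono cc dd _. Qed.

Lemma decides4_top c d : decides4 c d ⊤%F \top.
Proof.
split; rewrite /decides /=; last by auto with lattice.
  by apply: (@ent_contradiction ⊤%F); auto with lattice.
by apply: ent_and_r; apply: ent_trans ent_neg_top (ent_bot _).
Qed.

Lemma decides4_bot c d : decides4 c d ⊥%F \bot.
Proof.
split; rewrite /decides /=; last by auto with lattice.
  by apply: ent_or_l; apply: ent_trans (ent_top _) ent_sim_bot.
by apply: (@ent_exhaust ⊥%F); auto with lattice.
Qed.

Lemma four_join_eq0 (x y : four) :
  (x `|` y == \bot) = (x == \bot) && (y == \bot).
Proof. by case: x y => [[|[|[|[|?]]]] ?] [[|[|[|[|?]]]] ?]. Qed.

Lemma four_join_neq1 (x y : four) :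
  (x `|` y != \top) = (x != \top) && (y != \top).
Proof. by case: x y => [[|[|[|[|?]]]] ?] [[|[|[|[|?]]]] ?]. Qed.

Lemma four_meet_eq0 (x y : four) :
  (x `&` y == \bot) = (x == \bot) || (y == \bot).
Proof. by case: x y => [[|[|[|[|?]]]] ?] [[|[|[|[|?]]]] ?]. Qed.

Lemma four_meet_neq1 (x y : four) :
  (x `&` y != \top) = (x != \top) || (y != \top).
Proof. by case: x y => [[|[|[|[|?]]]] ?] [[|[|[|[|?]]]] ?]. Qed.

Lemma decides4_or c d f g x y :
  decides4 c d f x -> decides4 c d g y -> decides4 c d (f ∨ g)%F (x `|` y).
Proof.
move=> [F1 F2 F3] [G1 G2 G3]; split.
- rewrite four_join_eq0; apply: decides_equiv (decides_and F1 G1).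
    exact: ent_sim_or.
  by apply: ent_and; apply: ent_sim_contra; auto with lattice.
- rewrite four_join_neq1; apply: decides_equiv (decides_and F2 G2); first exact: neg_or.
  by apply: ent_and; apply: ent_neg_contra; auto with lattice.
- by rewrite lexU; apply: decides_or.
Qed.

Lemma decides4_and c d f g x y :
  decides4 c d f x -> decides4 c d g y -> decides4 c d (f ∧ g)%F (x `&` y).
Proof.
move=> [F1 F2 F3] [G1 G2 G3]; split.
- rewrite four_meet_eq0; apply: decides_equiv (decides_or F1 G1); last exact: sim_and.
  by apply: ent_or; apply: ent_sim_contra; auto with lattice.
- rewrite four_meet_neq1; apply: decides_equiv (decides_or F2 G2).
    by apply: ent_or; apply: ent_neg_contra; auto with lattice.
  exact: ent_neg_and.
- by rewrite lexI; apply: decides_and.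
Qed.

(** The decision on [∼ f] suffices: [∼ ∼ f] and [¬ ∼ f] are both complements of [∼ f]. *)
Lemma decides4_sim c d f x :
  decides4 c d f x -> decides4 c d (∼ f)%F (sim4 x).
Proof.
move=> [F _ _]; split.
- have -> : (sim4 x == \bot) = ~~ (x == \bot) by rewrite /sim4; case: ifP.
  exact: decides_compl (ent_sim_contradiction _) (ent_sim_stone _) F.
- have -> : (sim4 x != \top) = ~~ (x == \bot) by rewrite /sim4; case: ifP.
  apply: decides_compl (ent_neg_excluded_middle _) F.
  (* The Stone law gives [¬ ∼ f ⊢ ∼ ∼ f], which contradicts [∼ f]. *)
  apply: (@ent_contradiction (∼ f)%F); first by auto with lattice.
  apply: ent_and_r; apply: ent_neg_elim.
  by apply: ent_trans (ent_sim_stone f) _; auto with lattice.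
- by have -> : (u1 <= sim4 x) = (x == \bot) by rewrite /sim4; case: ifP.
Qed.

Lemma decides4_neg c d f x :
  decides4 c d f x -> decides4 c d (¬ f)%F (neg4 x).
Proof.
move=> [_ F _]; split.
- have -> : (neg4 x == \bot) = ~~ (x != \top) by rewrite /neg4; case: ifP.
  apply: decides_compl (ent_sim_contradiction _) _ F.
  (* Dually, [¬ ¬ f ⊢ ∼ ¬ f] by the Stone law for [¬]. *)
  apply: (@ent_exhaust (¬ f)%F); first by auto with lattice.
  apply: ent_or_r; apply: ent_sim_intro.
  by apply: ent_trans (ent_neg_stone f); auto with lattice.
- have -> : (neg4 x != \top) = ~~ (x != \top) by rewrite /neg4; case: ifP.
  exact: decides_compl (ent_neg_stone _) (ent_neg_excluded_middle _) F.
- by have -> : (u1 <= neg4 x) = (x != \top) by rewrite /neg4; case: ifP.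
Qed.

Lemma decides4_cut c d f :
  (forall x c' d', c' ⊢ c -> d ⊢ d' -> decides4 c' d' f x -> c' ⊢ d') -> c ⊢ d.
Proof.
move=> H; apply: (@decides_cut _ _ (∼ f)) => x c1 d1 cc1 dd1 F1.
apply: (@decides_cut _ _ (¬ f)) => y c2 d2 cc2 dd2 F2.
apply: (@decides_cut _ _ f) => z c3 d3 cc3 dd3 F3.
have {cc1}cc := ent_trans cc3 (ent_trans cc2 cc1).
have {dd1}dd := ent_trans dd1 (ent_trans dd2 dd3).
have {}F2 := decides_mono cc3 dd3 F2.
have {cc2 cc3 dd2 dd3}F1 :=
  decides_mono (ent_trans cc3 cc2) (ent_trans dd2 dd3) F1.
(* f ∧ ∼ f ⊢ ⊥ and ⊤ ⊢ f ∨ ¬ f rule out four of the eight cases; the other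
   four are the elements of the chain. *)
have [K0|K0] : decides c3 d3 (f ∧ ∼ f)%F true \/ ~~ (z && x).
  by case: (boolP (z && x)) (decides_and F3 F1) => [_|]; [left|right].
  apply: (ent_trans K0); apply: ent_or (ent_refl _).
  exact: ent_trans (ent_sim_contradiction _) (ent_bot _).
have [K1|K1] : decides c3 d3 (f ∨ ¬ f)%F false \/ z || y.
  by case: (boolP (z || y)) (decides_or F3 F2) => [|_]; [right|left].
  apply: ent_trans K1; apply: ent_and (ent_refl _) _.
  exact: ent_trans (ent_top _) (ent_neg_excluded_middle _).
move: x y z F1 F2 F3 K0 K1 => [] [] [] // F1 F2 F3 _ _.
- exact: (H \bot).
- exact: (H u1).
- exact: (H u2).
- exact: (H \top).
Qed.

(** * Evaluation and completeness *)

Fixpoint vars (f : formula) : seq nat :=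
  match f with
  | Var n => [:: n]
  | Top | Bot => [::]
  | Or f g | And f g => vars f ++ vars g
  | Sim f | Neg f => vars f
  end.

Fixpoint eval (u : nat -> four) (f : formula) : four :=
  match f with
  | Var n => u n
  | Top => \top
  | Bot => \bot
  | Or f g => eval u f `|` eval u g
  | And f g => eval u f `&` eval u g
  | Sim f => sim4 (eval u f)
  | Neg f => neg4 (eval u f)
  end.

Lemma eval_valuation u : valuation (eval u).
Proof. by []. Qed.

Lemma decides4_eval c d u f :
  {in vars f, forall n, decides4 c d (Var n) (u n)} ->
  decides4 c d f (eval u f).
Proof.
elim: f => [n|||f F g G|f F g G|f F|f F] /= H.
- by apply: H; rewrite inE.
- exact: decides4_top.
- exact: decides4_bot.
- by apply: decides4_or; [apply: F|apply: G] => n nP; apply: H;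
    rewrite mem_cat nP ?orbT.
- by apply: decides4_and; [apply: F|apply: G] => n nP; apply: H;
    rewrite mem_cat nP ?orbT.
- exact/decides4_sim/F.
- exact/decides4_neg/F.
Qed.

Lemma decides4_cut_vars (s : seq nat) c d :
  (forall u c' d', c' ⊢ c -> d ⊢ d' ->
     {in s, forall n, decides4 c' d' (Var n) (u n)} -> c' ⊢ d') ->
  c ⊢ d.
Proof.
elim: s => [|p s IHs] in c d *.
  (* With no variable to decide, any assignment will do. *)
  by move=> H; apply: (H (fun=> \bot)) => //; exact: ent_refl.
move=> H; apply: IHs => u c1 d1 cc1 dd1 sP.
apply: (@decides4_cut _ _ (Var p)) => x c2 d2 cc2 dd2 pP.
apply: (H [eta u with p |-> x]) => [||n].
- exact: ent_trans cc2 cc1.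
- exact: ent_trans dd1 dd2.
(* If [p] also occurs in [s], its latest value replaces the earlier one; decisions on other
   variables persist under refinement. *)
- rewrite inE /=; case: eqP => [-> //|_ /= ns].
  exact: decides4_mono cc2 dd2 (sP _ ns).
Qed.

Theorem theorem17 (a b : formula) : a ⊢ b <-> a ⊨ b.
Proof.
split=> [|ab]; first exact: entails_sound.
apply: (@decides4_cut_vars (vars a ++ vars b)) => u c d ca bd varsP.
have [|_ _ A] := @decides4_eval c d u a.
  by move=> n nP; apply: varsP; rewrite mem_cat nP.
have [|_ _ B] := @decides4_eval c d u b.
  by move=> n nP; apply: varsP; rewrite mem_cat nP orbT.
have {ab} := ab _ (eval_valuation u).
(* If [b] is decided in, [b ⊢ d] closes the goal. Otherwise the value of [a], being at most that of
   [b], is also not above [u1], so [a] is decided out although [c ⊢ a]. *)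
case: (boolP (u1 <= eval u b)) B => [_ B _|ub B ab].
  exact: ent_trans B (ent_or bd (ent_refl _)).
have ua : u1 <= eval u a = false.
  by apply: contraNF ub => ua; apply: le_trans ab.
by rewrite ua in A; apply: ent_trans A; apply: ent_and (ent_refl _) ca.
Qed.
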